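(* Let $d\ge1$, $u\in\mathcal G(\mathbb R^d)$ and $\alpha\in\mathbb R$, and suppose $u\ne 0$ is homogeneous of degree $\alpha$, i.e. for every $\lambda\in\mathbb R^+$ the equality $u(\lambda x)=\lambda^\alpha u(x)$ holds in $\mathcal G(\mathbb R^d)$. Then: (1) $\alpha\in\mathbb N_0$; (2) $u$ is a homogeneous polynomial of degree $\alpha$ in the $d$ variables $x_1,\dots,x_d$ with coefficients in $\widetilde{\mathbb C}$.
   Context: For $\Omega\subseteq\mathbb R^d$ open, the special Colombeau algebra is $\mathcal G(\Omega):=\mathcal E_M(\Omega)/\mathcal N(\Omega)$, where $\mathcal E_M(\Omega)$ is the set of nets $(u_\varepsilon)_{\varepsilon\in(0,1]}$ of (complex-valued) functions in $C^\infty(\Omega)$ such that for every compact $K\subset\Omega$ and every $\beta\in\mathbb N_0^d$ there is $N\ge 0$ with $\sup_{x\in K}|\partial^\beta u_\varepsilon(x)|=O(\varepsilon^{-N})$ as $\varepsilon\to 0$, and $\mathcal N(\Omega)$ is the set of nets such that for every compact $K\subset \Omega$, every $\beta\in\mathbb N_0^d$ and every $m\ge 0$, $\sup_{x\in K}|\partial^\beta u_\varepsilon(x)|=O(\varepsilon^{m})$ as $\varepsilon\to 0$. Operations are componentwise on representatives; $u(\lambda x)$ is the class of $(x\mapsto u_\varepsilon(\lambda x))_\varepsilon$; $\mathbb R^+=(0,\infty)$. The ring of generalized numbers $\widetilde{\mathbb C}$ is the set of nets $(c_\varepsilon)_{\varepsilon\in(0,1]}$ in $\mathbb C$ with $|c_\varepsilon|=O(\varepsilon^{-N})$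 for some $N$, modulo nets with $|c_\varepsilon|=O(\varepsilon^p)$ for all $p\ge0$. A polynomial in $\widetilde{\mathbb C}[x_1,\dots,x_d]$ is regarded as an element of $\mathcal G(\mathbb R^d)$ by choosing representatives of its coefficients. *)

(* Defs.v *)
From HB Require Import structures.
From mathcomp Require Import all_boot all_order all_algebra.
From mathcomp Require Import all_classical all_reals all_analysis.
From mathcomp Require Import generic_quotient ring_quotient complex.
(* mpoly is imported without its notations, which clash with those of
   mathcomp-analysis: [mpoly n A] is {mpoly A[n]}, [mcoeff m p] is p@_m,
   [multinom n] is 'X_{1..n} and [ishomog1 k (@mdeg n)] is k.-homog. *)
From mathcomp Require Import -(notations) mpoly.

Set Implicit Arguments.
Unset Strict Implicit.
Unset Printing Implicit Defensive.
Import Order.TTheory GRing.Theory Num.Theory numFieldNormedType.Exports.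

Local Open Scope classical_set_scope.
Local Open Scope ring_scope.
Local Open Scope quotient_scope.
Local Open Scope complex_scope.

(** * Nets indexed by ]0, 1] *)

Definition eps (R : realType) : Type := {e : R | 0 < e <= 1}.

Section Eps.
Variable R : realType.

Fact eps1_subproof : 0 < (1 : R) <= 1. Proof. by rewrite ltr01 lexx. Qed.

HB.instance Definition _ := Choice.on (eps R).
HB.instance Definition _ :=
  isPointed.Build (eps R) (exist _ (1 : R) eps1_subproof).

Lemma eps_gt0 (e : eps R) : 0 < val e.
Proof. by case/andP: (valP e). Qed.

Lemma eps_le1 (e : eps R) : val e <= 1.
Proof. by case/andP: (valP e). Qed.

(* f e = O(e ^ p) as e -> 0.  No absolute value is taken: the definition is
   only used for moduli and for suprema of moduli. *)
Definition bigO_eps (f : eps R -> \bar R) (p : int) : Prop :=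
  exists C eta : R, 0 < eta /\
    forall e : eps R, val e < eta -> (f e <= (C * val e ^ p)%:E)%E.

End Eps.

(** * The ring of generalized complex numbers *)

Section GeneralizedNumbers.
Variable R : realType.
Local Notation normc := (@ComplexField.Normc.normc R).

Definition moderate_num (c : eps R -> R[i]) : Prop :=
  exists N : nat, bigO_eps (fun e => (normc (c e))%:E) (- N%:Z).

Definition negligible_num (c : eps R -> R[i]) : Prop :=
  forall p : nat, bigO_eps (fun e => (normc (c e))%:E) p%:Z.

Lemma normcN (x : R[i]) : normc (- x) = normc x.
Proof. by case: x => a b /=; rewrite !sqrrN. Qed.

Lemma normc_ge0 (x : R[i]) : 0 <= normc x.
Proof. by case: x => a b /=; exact: sqrtr_ge0. Qed.

Lemma normcD (x y : R[i]) : normc (x + y) <= normc x + normc y.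
Proof.
have := ler_normD x y; rewrite !normc_def -rmorphD lecR.
by case: x y => a b [c d].
Qed.

Lemma bigO_real (F : eps R -> R) p :
  bigO_eps (fun e => (F e)%:E) p <->
  exists C eta : R, [/\ 0 <= C, 0 < eta &
    forall e : eps R, val e < eta -> F e <= C * val e ^ p].
Proof.
split=> -[C [eta]] => [[eta0 H]|[C0 eta0 H]].
  exists `|C|, eta; split => // e /H; rewrite lee_fin => /le_trans; apply.
  by rewrite ler_pM2r ?ler_norm// exprz_gt0// eps_gt0.
by exists C, eta; split => // e /H; rewrite lee_fin.
Qed.

Lemma eps_exp_le (e : eps R) (p q : int) : p <= q -> val e ^ q <= val e ^ p.
Proof.
move=> pq; have e0 := eps_gt0 e.
rewrite -(subrK p q) expfzDr ?gt_eqF// ler_piMl// ?exprz_ge0 ?(ltW e0)//.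
have : 0 <= q - p by rewrite subr_ge0.
by case: (q - p) => // n _; apply: exprn_ile1; rewrite ?eps_le1// ltW.
Qed.

Lemma bigO_addmul (A F G : eps R -> R) p q r :
  (forall e, 0 <= F e) ->
  bigO_eps (fun e => (A e)%:E) p -> bigO_eps (fun e => (F e)%:E) q ->
  bigO_eps (fun e => (G e)%:E) r ->
  bigO_eps (fun e => (A e * F e + G e)%:E) (Order.min (p + q) r).
Proof.
move=> F0 /bigO_real[C1 [e1 [C10 e10 H1]]] /bigO_real[C2 [e2 [C20 e20 H2]]].
move=> /bigO_real[C3 [e3 [C30 e30 H3]]].
apply/bigO_real; exists (C1 * C2 + C3), (Order.min e1 (Order.min e2 e3)).
split; [by rewrite addr_ge0// mulr_ge0 | by rewrite !lt_min e10 e20 e30|].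
move=> e; rewrite !lt_min => /and3P[l1 l2 l3].
rewrite mulrDl lerD//.
- apply: (@le_trans _ _ ((C1 * val e ^ p) * (C2 * val e ^ q))).
    apply: (@le_trans _ _ ((C1 * val e ^ p) * F e)).
      by rewrite ler_wpM2r// H1.
    by rewrite ler_wpM2l ?H2// mulr_ge0// exprz_ge0// ltW// eps_gt0.
  rewrite mulrACA -expfzDr ?gt_eqF ?eps_gt0// ler_wpM2l ?mulr_ge0//.
  by apply: eps_exp_le; rewrite ge_min lexx.
- apply: (le_trans (H3 _ l3)); rewrite ler_wpM2l//.
  by apply: eps_exp_le; rewrite ge_min lexx orbT.
Qed.

Lemma bigO_le (F G : eps R -> R) p q : q <= p -> (forall e, F e <= G e) ->
  bigO_eps (fun e => (G e)%:E) p -> bigO_eps (fun e => (F e)%:E) q.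
Proof.
move=> qp FG /bigO_real[C [eta [C0 eta0 H]]].
apply/bigO_real; exists C, eta; split => // e /H He.
apply: (le_trans (FG e)); apply: (le_trans He).
by rewrite ler_wpM2l// eps_exp_le.
Qed.

Definition moderate_num_pred : {pred eps R -> R[i]} :=
  fun c => `[< moderate_num c >].

Fact moderate_num_subproof : subring_closed moderate_num_pred.
Proof.
have cst1 : moderate_num 1.
  exists 0%N; apply/bigO_real; exists 1, 1; split => // e _.
  by rewrite ComplexField.Normc.normc1 oppr0 expr0z mulr1.
have mD a u v : moderate_num a -> moderate_num u -> moderate_num v ->
    moderate_num (a * u + v).
  move=> [N1 H1] [N2 H2] [N3 H3]; exists (N1 + N2 + N3)%N.
  apply: bigO_le (bigO_addmul (fun e => normc_ge0 (u e)) H1 H2 H3).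
    by rewrite le_min -opprD -PoszD !lerN2 !lez_nat leq_addr leq_addl.
  move=> e; apply: (le_trans (normcD _ _)).
  by rewrite ComplexField.Normc.normcM.
have mN u : moderate_num u -> moderate_num (- u).
  by move=> [N H]; exists N; apply: bigO_le H => // e; rewrite normcN.
split; first exact/asboolP.
- move=> u v /asboolP mu /asboolP mv; apply/asboolP.
  by rewrite -[u]mul1r; apply: mD => //; exact: mN.
- move=> u v /asboolP mu /asboolP mv; apply/asboolP.
  rewrite -[u * v]addr0; apply: (mD) => //.
  by rewrite -(subrr 1) -[X in X - _]mulr1; apply: (mD) => //; exact: mN.
Qed.

HB.instance Definition _ :=
  GRing.isSubringClosed.Build (eps R -> R[i]) moderate_num_pred
    moderate_num_subproof.

Record moderate_number := ModerateNumber {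
  mnum_net :> eps R -> R[i];
  _ : mnum_net \in moderate_num_pred }.

HB.instance Definition _ := [isSub for mnum_net].
HB.instance Definition _ := [Choice of moderate_number by <:].
HB.instance Definition _ :=
  [SubChoice_isSubComNzRing of moderate_number by <:].

Definition negligible_num_pred : {pred moderate_number} :=
  fun c => `[< negligible_num c >].

Fact negligible_num_subproof : idealr_closed negligible_num_pred.
Proof.
split.
- apply/asboolP => p; apply/bigO_real; exists 0, 1; split => // e _.
  by rewrite mul0r ComplexField.Normc.normc0.
- apply/asboolP => /(_ 1%N) /bigO_real[C [eta [C0 eta0 H]]].
  pose t : R := Order.min (eta / 2) (Order.min 1 ((C + 1)^-1 / 2)).
  have C1 : 0 < C + 1 by rewrite ltr_pwDr.
  have t0 : 0 < t by rewrite !lt_min ltr01 !divr_gt0// invr_gt0.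
  have t1 : 0 < t <= 1 by rewrite t0 !ge_min lexx !orbT.
  have teta : t < eta by rewrite !gt_min ltr_pdivrMr// ltr_pMr// ltr1n.
  have : normc (1 : R[i]) <= C * t ^ 1%:Z := H (exist _ t t1) teta.
  apply/negP; rewrite -ltNge ComplexField.Normc.normc1.
  apply: (@le_lt_trans _ _ ((C + 1) * ((C + 1)^-1 / 2))).
    apply: ler_pM => //; [exact: ltW|by rewrite lerDl|].
    by rewrite expr1z !ge_min lexx !orbT.
  by rewrite mulrA divff ?gt_eqF// mul1r invf_lt1// ltr1n.
- move=> a u v /asboolP nu /asboolP nv; apply/asboolP => p.
  have /asboolP[N HN] := valP a.
  apply: bigO_le (bigO_addmul (fun e => normc_ge0 (u e)) HN
    (nu (N + p)%N) (nv p)).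
    by rewrite le_min lexx PoszD addKr lexx.
  move=> e; apply: (le_trans (normcD _ _)).
  by rewrite ComplexField.Normc.normcM.
Qed.

HB.instance Definition _ :=
  isIdealr.Build moderate_number negligible_num_pred negligible_num_subproof.

Definition gcomplex : Type := {ideal_quot negligible_num_pred}.
HB.instance Definition _ := GRing.ComNzRing.on gcomplex.
HB.instance Definition _ := NzRingQuotient.on gcomplex.

End GeneralizedNumbers.

(** * Iterated partial derivatives *)

Section RealDerivatives.
Variables (R : realType) (d : nat).
Local Notation V := 'rV[R]_d.
Implicit Types (f g : V -> R) (s : seq 'I_d).

Definition partials (s : seq 'I_d) (f : V -> R) : V -> R :=
  foldr (fun i (g : V -> R) => 'D_(delta_mx 0 i) g) f s.

(* C^oo: every iterated partial derivative is continuous and has first-order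
   partial derivatives everywhere. *)
Definition smooth_real (f : V -> R) : Prop := forall s : seq 'I_d,
  continuous (partials s f) /\
  forall (i : 'I_d) (x : V), derivable (partials s f) x (delta_mx 0 i).

Lemma partials_lin s a f g : smooth_real f -> smooth_real g ->
  partials s (a *: f + g) = a *: partials s f + partials s g.
Proof.
move=> sf sg; elim: s => //= i s ->; apply/funext => x.
have df := (sf s).2 i x; have dg := (sg s).2 i x.
rewrite deriveD//; last exact: derivableZ.
by rewrite deriveZ.
Qed.

Lemma partialsZ s a f : smooth_real f -> partials s (a *: f) = a *: partials s f.
Proof.
move=> sf; elim: s => //= i s ->; apply/funext => x.
by rewrite deriveZ//; exact: (sf s).2.
Qed.

Lemma smooth_real_lin a f g : smooth_real f -> smooth_real g ->
  smooth_real (a *: f + g).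
Proof.
move=> sf sg s; rewrite partials_lin//; split.
  move=> x; apply: continuousD; last exact: (sg s).1.
  by apply: continuousZl_tmp; exact: (sf s).1.
move=> i x; apply: derivableD; last exact: (sg s).2.
by apply: derivableZ; exact: (sf s).2.
Qed.

Lemma derive_dilate f (l : R) (x v : V) : derivable f (l *: x) v ->
  is_derive x v (fun y => f (l *: y)) (l * 'D_v f (l *: x)).
Proof.
move=> df; have [->|l0] := eqVneq l 0.
  rewrite mul0r (_ : (fun y => _) = cst (f 0)); first exact: is_derive_cst.
  by apply/funext => y; rewrite scale0r.
set q := fun h : R => h^-1 *: ((f \o shift (l *: x)) (h *: v) - f (l *: x)).
have ql : (fun h : R => q (l * h)) @ 0^' --> 'D_v f (l *: x).
  apply: (@cvg_comp _ _ _ (fun h : R => l * h) q _ (0^')); last exact: df.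
  move=> A /nbhs_ballP[e /= e0 HA]; apply/nbhs_ballP.
  exists (e / `|l|) => /=; first by rewrite divr_gt0// normr_gt0.
  move=> h; rewrite /ball/= sub0r normrN => he h0; apply: HA.
    by rewrite /ball/= sub0r normrN normrM mulrC -ltr_pdivlMr// normr_gt0.
  by rewrite mulf_neq0.
have H : (fun h : R => h^-1 *: (((fun y => f (l *: y)) \o shift x) (h *: v)
    - f (l *: x))) @ 0^' --> l * 'D_v f (l *: x).
  have -> : (fun h : R => h^-1 *: (((fun y => f (l *: y)) \o shift x) (h *: v)
    - f (l *: x))) = (fun h => l * q (l * h)).
    apply/funext => h; rewrite /q /= [l *: (_ + _)]scalerDr scalerA invfM.
    by rewrite -[RHS]/(l * (l^-1 * h^-1 * _)) !mulrA divff// mul1r.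
  by apply: cvgM => //; exact: cvg_cst.
by apply: DeriveDef; [apply/cvg_ex; eexists; exact: H|exact/cvg_lim].
Qed.

Lemma partials_dilate s f (l : R) : smooth_real f ->
  partials s (fun x => f (l *: x)) = fun x => l ^+ size s * partials s f (l *: x).
Proof.
move=> sf; elim: s => /= [|i s ->]; first by apply/funext => x; rewrite mul1r.
apply/funext => x.
have D := derive_dilate ((sf s).2 i (l *: x)).
have := is_deriveZ (l ^+ size s) D.
move=> /@derive_val; rewrite /= => ->.
by rewrite exprSr -mulrA.
Qed.

Lemma smooth_real_dilate f (l : R) : smooth_real f ->
  smooth_real (fun x => f (l *: x)).
Proof.
move=> sf s; rewrite partials_dilate//; split.
  move=> x; have c1 : (fun y : V => l *: y) y @[y --> x] --> l *: x.
    exact: (@scaler_continuous _ _ l x).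
  have c2 := cvg_comp _ _ c1 ((sf s).1 (l *: x)).
  exact: (@cvgMl_tmp _ _ _ _ _ (l ^+ size s) _ c2).
move=> i x; have D := derive_dilate ((sf s).2 i (l *: x)).
by have [] := is_deriveZ (l ^+ size s) D.
Qed.

(* polynomial functions *)
Inductive polyfun : (V -> R) -> Prop :=
| polyfun_cst c : polyfun (cst c)
| polyfun_coord i : polyfun (fun x : V => x 0 i)
| polyfun_add f g : polyfun f -> polyfun g -> polyfun (f + g)
| polyfun_mul f g : polyfun f -> polyfun g -> polyfun (f * g).

Lemma polyfun_derive f : polyfun f -> continuous f /\
  forall v, (forall x, derivable f x v) /\ polyfun ('D_v f).
Proof.
elim => {f} [c|i|f g pf [cf df] pg [cg dg]|f g pf [cf df] pg [cg dg]].
- split=> [|v]; first exact: cst_continuous.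
  split=> [x|]; first exact: derivable_cst.
  rewrite (_ : 'D_v _ = cst 0); first exact: polyfun_cst.
  by apply/funext => x; rewrite derive_cst.
- split=> [|v]; first exact: coord_continuous.
  have H x : is_derive x v (fun x : V => x 0 i) (v 0 i).
    have H : (fun h : R => h^-1 *: (((fun x : V => x 0 i : R) \o shift x) (h *: v)
        - x 0 i)) @ 0^' --> v 0 i.
      apply: (@cvg_trans _ (cst (v 0 i) @ 0^')); last exact: cvg_cst.
      apply: near_eq_cvg; near=> h.
      rewrite /= !mxE addrK -[RHS]/(h^-1 * (h * v 0 i)) mulKf//.
      by near: h; exact: nbhs_dnbhs_neq.
    by apply: DeriveDef; [apply/cvg_ex; eexists; exact: H|exact/cvg_lim].
  split=> [x|]; first by have [] := H x.
  rewrite (_ : 'D_v _ = cst (v 0 i)); first exact: polyfun_cst.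
  by apply/funext => x; have [] := H x.
- split=> [x|v]; first by apply: continuousD; [exact: cf|exact: cg].
  have [[d1 p1] [d2 p2]] := (df v, dg v).
  split=> [x|]; first exact: derivableD.
  rewrite (_ : 'D_v _ = 'D_v f + 'D_v g); first exact: polyfun_add.
  by apply/funext => x; rewrite deriveD.
- split=> [x|v]; first by apply: continuousM; [exact: cf|exact: cg].
  have [[d1 p1] [d2 p2]] := (df v, dg v).
  split=> [x|]; first exact: derivableM.
  rewrite (_ : 'D_v _ = f * 'D_v g + g * 'D_v f).
    by apply: polyfun_add; apply: polyfun_mul.
  by apply/funext => x; rewrite deriveM.
Unshelve. all: by end_near. Qed.

Lemma polyfun_partials s f : polyfun f -> polyfun (partials s f).
Proof. by move=> pf; elim: s => //= i s /polyfun_derive[_ /(_ (delta_mx 0 i)) []]. Qed.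

Lemma polyfun_smooth f : polyfun f -> smooth_real f.
Proof.
move=> pf s; have [c dd] := polyfun_derive (polyfun_partials s pf).
by split => // i x; have [] := dd (delta_mx 0 i).
Qed.

Definition monomial (m : multinom d) (x : V) : R := \prod_(i < d) x 0 i ^+ m i.

Lemma polyfun_monomial m : polyfun (monomial m).
Proof.
rewrite (_ : monomial m =
    \prod_(i < d) (fun x : V => x 0 i : R) ^+ m i); last first.
  apply/funext => x; rewrite /monomial fct_prodE; apply: eq_bigr => i _.
  by elim: (m i) => [|n IH]; rewrite ?expr0// !exprS IH.
apply: (big_ind polyfun) => [|f g|i _]; first exact: polyfun_cst.
  exact: polyfun_mul.
elim: (m i) => [|n IH]; first by rewrite expr0; exact: polyfun_cst.
by rewrite exprS; apply: polyfun_mul => //; exact: polyfun_coord.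
Qed.

Lemma compact_continuous_bound (K : set V) f : compact K -> continuous f ->
  exists2 M : R, 0 <= M & forall x, K x -> `|f x| <= M.
Proof.
move=> cK cf.
have : compact (f @` K).
  by apply: continuous_compact => //; exact: continuous_subspaceT.
move=> /compact_bounded[M0 [M0r H]].
exists (`|M0| + 1); first by rewrite addr_ge0.
move=> x Kx; apply: (H (`|M0| + 1)); last by exists x.
by rewrite (le_lt_trans (ler_norm _))// ltrDl.
Qed.

End RealDerivatives.

(** * Colombeau generalized functions on R^d, as an R-module *)

Section Colombeau.
Variables (R : realType) (d : nat).
Local Notation V := 'rV[R]_d.
(* [Rcomplex R] is R[i] endowed with its R-module structure. *)
Local Notation C := (Rcomplex R).
Local Notation normc := (@ComplexField.Normc.normc R).
Local Notation net := (eps R -> V -> C).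
Implicit Types (f g : V -> C) (s : seq 'I_d) (K : set V).

Definition smooth (f : V -> C) : Prop :=
  smooth_real (fun x => complex.Re (f x)) /\ smooth_real (fun x => complex.Im (f x)).

Definition cpartials (s : seq 'I_d) (f : V -> C) : V -> C := fun x =>
  partials s (fun y => complex.Re (f y)) x +i* partials s (fun y => complex.Im (f y)) x.

(* d_1^(beta_1) ... d_d^(beta_d) *)
Definition multi_partial (beta : multinom d) : (V -> C) -> (V -> C) :=
  cpartials (flatten [seq nseq (beta i) i | i <- enum 'I_d]).

Definition sup_norm (K : set V) (f : V -> C) : \bar R :=
  ereal_sup [set (normc (f x))%:E | x in K].

Definition moderate_net (u : net) : Prop := (forall e, smooth (u e)) /\
  forall (K : set V) (beta : multinom d), compact K -> exists N : nat,
    bigO_eps (fun e => sup_norm K (multi_partial beta (u e))) (- N%:Z).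

Definition negligible_net (u : net) : Prop :=
  forall (K : set V) (beta : multinom d) (m : nat), compact K ->
    bigO_eps (fun e => sup_norm K (multi_partial beta (u e))) m%:Z.

Lemma bigO_sup K (F : net) p :
  bigO_eps (fun e => sup_norm K (F e)) p <->
  exists C0 eta : R, [/\ 0 <= C0, 0 < eta & forall e : eps R, val e < eta ->
    forall x, K x -> normc (F e x) <= C0 * val e ^ p].
Proof.
split=> -[C0 [eta]] => [[eta0 H]|[C00 eta0 H]].
  exists `|C0|, eta; split => // e /H He x Kx.
  apply: (@le_trans _ _ (C0 * val e ^ p)); last first.
    by rewrite ler_pM2r ?ler_norm// exprz_gt0// eps_gt0.
  by rewrite -lee_fin; apply: le_trans He; apply: ereal_sup_ubound; exists x.
exists C0, eta; split => // e /H He; apply: ge_ereal_sup => _ [x Kx <-].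
by rewrite lee_fin He.
Qed.

Lemma normcZ (a : R) (z : C) : normc (a *: z) = `|a| * normc z.
Proof.
case: z => b c /=.
by rewrite !exprMn -mulrDr sqrtrM ?sqr_ge0// sqrtr_sqr.
Qed.

Lemma bigO_sup_lin K a (F G : net) p q :
  bigO_eps (fun e => sup_norm K (F e)) p ->
  bigO_eps (fun e => sup_norm K (G e)) q ->
  bigO_eps (fun e => sup_norm K (a *: F e + G e)) (Order.min p q).
Proof.
move=> /bigO_sup[C1 [e1 [C10 e10 H1]]] /bigO_sup[C2 [e2 [C20 e20 H2]]].
apply/bigO_sup; exists (`|a| * C1 + C2), (Order.min e1 e2).
split; [by rewrite addr_ge0// mulr_ge0 | by rewrite lt_min e10 e20 |].
move=> e; rewrite lt_min => /andP[l1 l2] x Kx.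
apply: (le_trans (normcD _ _)); rewrite normcZ mulrDl lerD//.
  rewrite -mulrA ler_wpM2l//; apply: (le_trans (H1 _ l1 _ Kx)).
  by rewrite ler_wpM2l// eps_exp_le// ge_min lexx.
apply: (le_trans (H2 _ l2 _ Kx)).
by rewrite ler_wpM2l// eps_exp_le// ge_min lexx orbT.
Qed.

Lemma Re_lin a f g :
  (fun x => complex.Re ((a *: f + g) x)) = a *: (fun x => complex.Re (f x)) + (fun x => complex.Re (g x)).
Proof. by apply/funext => x /=; rewrite !fctE; case: (f x) (g x) => ? ? [? ?]. Qed.

Lemma Im_lin a f g :
  (fun x => complex.Im ((a *: f + g) x)) = a *: (fun x => complex.Im (f x)) + (fun x => complex.Im (g x)).
Proof. by apply/funext => x /=; rewrite !fctE; case: (f x) (g x) => ? ? [? ?]. Qed.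

Lemma smooth_lin a f g : smooth f -> smooth g -> smooth (a *: f + g).
Proof.
move=> [rf jf] [rg jg]; split.
  by rewrite Re_lin; exact: smooth_real_lin.
by rewrite Im_lin; exact: smooth_real_lin.
Qed.

Lemma cpartials_lin s a f g : smooth f -> smooth g ->
  cpartials s (a *: f + g) = a *: cpartials s f + cpartials s g.
Proof.
move=> [rf jf] [rg jg]; apply/funext => x.
by rewrite /cpartials Re_lin Im_lin !partials_lin.
Qed.

Lemma smooth_cmul (c : C) (f : V -> R) : smooth_real f ->
  smooth (fun x => c * (f x)%:C).
Proof.
move=> sf; case: c => a b.
have s0 : smooth_real (0 : V -> R) by apply: polyfun_smooth; exact: polyfun_cst.
split.
  rewrite (_ : (fun x => _) = a *: f + 0); first exact: smooth_real_lin.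
  by apply/funext => x /=; rewrite mulr0 subr0 addr0.
rewrite (_ : (fun x => _) = b *: f + 0); first exact: smooth_real_lin.
by apply/funext => x /=; rewrite mulr0 add0r addr0.
Qed.

Lemma cpartials_cmul s (c : C) (f : V -> R) : smooth_real f ->
  cpartials s (fun x => c * (f x)%:C) = fun x => c * (partials s f x)%:C.
Proof.
move=> sf; case: c => a b; apply/funext => x; rewrite /cpartials.
rewrite (_ : (fun y => complex.Re _) = a *: f); last first.
  by apply/funext => y /=; rewrite mulr0 subr0.
rewrite (_ : (fun y => complex.Im _) = b *: f); last first.
  by apply/funext => y /=; rewrite mulr0 add0r.
rewrite !partialsZ// -[RHS]/((_ +i* _) : C).
by rewrite !mulr0 subr0 add0r.
Qed.

Definition moderate_net_pred : {pred net} := fun u => `[< moderate_net u >].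

Lemma bigO_sup_le K (F : net) p q : q <= p ->
  bigO_eps (fun e => sup_norm K (F e)) p ->
  bigO_eps (fun e => sup_norm K (F e)) q.
Proof.
move=> qp /bigO_sup[C0 [eta [C00 eta0 H]]]; apply/bigO_sup.
exists C0, eta; split => // e /H He x /He /le_trans; apply.
by rewrite ler_wpM2l// eps_exp_le.
Qed.

Lemma smooth0 : smooth 0.
Proof. by split; apply: polyfun_smooth; exact: polyfun_cst. Qed.

Lemma cpartials0 s : cpartials s 0 = 0.
Proof.
have := cpartials_lin s (-1) smooth0 smooth0.
by rewrite !scaleN1r !addNr.
Qed.

Lemma negligible_net0 : negligible_net 0.
Proof.
move=> K beta m cK; apply/bigO_sup; exists 0, 1; split => // e _ x _.
by rewrite /multi_partial cpartials0 mul0r ComplexField.Normc.normc0.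
Qed.

Fact moderate_net_subproof : submod_closed moderate_net_pred.
Proof.
split.
  apply/asboolP; split=> [e|K beta cK]; first exact: smooth0.
  by exists 0%N; exact: (negligible_net0 beta 0 cK).
move=> a u v /asboolP[su mu] /asboolP[sv mv]; apply/asboolP.
split=> [e|K beta cK]; first exact: smooth_lin.
have [N1 H1] := mu K beta cK; have [N2 H2] := mv K beta cK.
exists (N1 + N2)%N; apply: (@bigO_sup_le _ _ (Order.min (- N1%:Z) (- N2%:Z))).
  by rewrite le_min !lerN2 !lez_nat leq_addr leq_addl.
have := bigO_sup_lin a H1 H2.
by under [in X in X -> _]eq_fun do rewrite /multi_partial -cpartials_lin//.
Qed.

HB.instance Definition _ :=
  GRing.isSubmodClosed.Build R net moderate_net_pred moderate_net_subproof.

Record moderate := Moderate {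
  mod_net :> net;
  _ : mod_net \in moderate_net_pred }.

HB.instance Definition _ := [isSub for mod_net].
HB.instance Definition _ := [Choice of moderate by <:].
HB.instance Definition _ := [SubChoice_isSubLmodule of moderate by <:].

Lemma moderateP (u : moderate) : moderate_net u.
Proof. exact/asboolP/(valP u). Qed.

Definition negligible_net_pred : {pred moderate} :=
  fun u => `[< negligible_net u >].

Fact negligible_net_subproof : submod_closed negligible_net_pred.
Proof.
split; first by apply/asboolP; exact: negligible_net0.
move=> a u v /asboolP nu /asboolP nv; apply/asboolP => K beta m cK.
have := bigO_sup_lin a (nu K beta m cK) (nv K beta m cK); rewrite minxx.
have [su _] := moderateP u; have [sv _] := moderateP v.
by under [in X in X -> _]eq_fun do rewrite /multi_partial -cpartials_lin//.
Qed.

HB.instance Definition _ :=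
  GRing.isSubmodClosed.Build R moderate negligible_net_pred
    negligible_net_subproof.

Definition colombeau : Type := @Quotient.quot _ negligible_net_pred.
HB.instance Definition _ := GRing.Zmodule.on colombeau.
HB.instance Definition _ := ZmodQuotient.on colombeau.

Lemma colombeau_eqP (u v : moderate) :
  reflect (negligible_net (mod_net (u - v))) (\pi_colombeau u == \pi_colombeau v).
Proof. by rewrite -Quotient.idealrBE; exact: asboolP. Qed.

Definition colombeau_scale (a : R) (u : colombeau) : colombeau :=
  \pi_colombeau (a *: repr u).

Lemma pi_colombeau_scale a (u : moderate) :
  colombeau_scale a (\pi_colombeau u) = \pi_colombeau (a *: u).
Proof.
apply/eqP; rewrite /colombeau_scale -Quotient.idealrBE -scalerBr rpredZ//.
by rewrite Quotient.idealrBE reprK.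
Qed.

Fact colombeau_scalerA a b u :
  colombeau_scale a (colombeau_scale b u) = colombeau_scale (a * b) u.
Proof. by rewrite -[u]reprK (pi_colombeau_scale b) !(pi_colombeau_scale, scalerA). Qed.

Fact colombeau_scale1r u : colombeau_scale 1 u = u.
Proof. by rewrite -[u]reprK pi_colombeau_scale scale1r. Qed.

Fact colombeau_scalerDr a u v :
  colombeau_scale a (u + v) = colombeau_scale a u + colombeau_scale a v.
Proof.
rewrite -[u]reprK -[v]reprK -raddfD (pi_colombeau_scale _ (repr u + repr v)).
by rewrite (pi_colombeau_scale _ (repr u)) (pi_colombeau_scale _ (repr v))
  scalerDr raddfD.
Qed.

Fact colombeau_scalerDl u a b :
  colombeau_scale (a + b) u = colombeau_scale a u + colombeau_scale b u.
Proof. by rewrite -[u]reprK !(pi_colombeau_scale _ (repr u)) scalerDl raddfD. Qed.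

HB.instance Definition _ := GRing.Zmodule_isLmodule.Build R colombeau
  colombeau_scalerA colombeau_scale1r colombeau_scalerDr colombeau_scalerDl.

(** ** Dilations *)

Lemma multi_partial_dilate (beta : multinom d) f (l : R) : smooth f ->
  multi_partial beta (fun x => f (l *: x)) = fun x =>
    l ^+ size (flatten [seq nseq (beta i) i | i <- enum 'I_d]) *:
      multi_partial beta f (l *: x).
Proof.
move=> [rf jf].
apply/funext => x; rewrite /multi_partial /cpartials.
by rewrite !(@partials_dilate _ _ _ (fun y => _ (f y))).
Qed.

Lemma bigO_sup_dilate K beta (l : R) (u : net) p : (forall e, smooth (u e)) ->
  bigO_eps (fun e => sup_norm [set l *: x | x in K] (multi_partial beta (u e))) p ->
  bigO_eps
    (fun e => sup_norm K (multi_partial beta (fun x => u e (l *: x)))) p.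
Proof.
move=> su /bigO_sup[C0 [eta [C00 eta0 H]]].
pose n := size (flatten [seq nseq (beta i) i | i <- enum 'I_d]).
apply/bigO_sup; exists (`|l ^+ n| * C0), eta; split => //.
  by rewrite mulr_ge0.
move=> e He x Kx; rewrite (multi_partial_dilate _ _ (su e)) normcZ -mulrA.
by rewrite ler_wpM2l// H//; exists x.
Qed.

Lemma compact_dilate K (l : R) : compact K -> compact [set l *: x | x in K].
Proof.
move=> cK; apply: continuous_compact => //; apply: continuous_subspaceT => x.
exact: scaler_continuous.
Qed.

Fact dilate_net_subproof (l : R) (u : moderate) :
  (fun e x => u e (l *: x)) \in moderate_net_pred.
Proof.
have [su mu] := moderateP u; apply/asboolP; split=> [e|K beta cK].
  by have [re im] := su e; split;
    [exact: (smooth_real_dilate l re)|exact: (smooth_real_dilate l im)].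
have [N HN] := mu _ beta (@compact_dilate _ l cK); exists N.
exact: bigO_sup_dilate.
Qed.

Definition dilate_moderate (l : R) (u : moderate) : moderate :=
  Moderate (dilate_net_subproof l u).

(* the class of x |-> u(l x) *)
Definition dilate (l : R) (u : colombeau) : colombeau :=
  \pi_colombeau (dilate_moderate l (repr u)).

Lemma pi_dilate l (u : moderate) :
  dilate l (\pi_colombeau u) = \pi_colombeau (dilate_moderate l u).
Proof.
apply/eqP/colombeau_eqP => K beta m cK.
set v := repr _; have /colombeau_eqP vu : \pi_colombeau v == \pi_colombeau u.
  by rewrite reprK.
have [s _] := moderateP (v - u).
exact: (bigO_sup_dilate s (vu _ beta m (@compact_dilate _ l cK))).
Qed.

Definition homogeneous (alpha : R) (u : colombeau) : Prop :=
  forall lambda : R, 0 < lambda -> dilate lambda u = (lambda `^ alpha) *: u.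

(** ** Polynomials with generalized coefficients *)

Lemma bigO_sup_monomial K beta (c : eps R -> C) (m : multinom d) p :
  compact K -> bigO_eps (fun e => (normc (c e))%:E) p ->
  bigO_eps (fun e => sup_norm K
    (multi_partial beta (fun x => c e * (monomial m x)%:C))) p.
Proof.
move=> cK /bigO_real[C0 [eta [C00 eta0 H]]].
have pm := polyfun_monomial R m.
have [M M0 HM] := compact_continuous_bound cK
  (polyfun_derive (polyfun_partials
    (flatten [seq nseq (beta i) i | i <- enum 'I_d]) pm)).1.
apply/bigO_sup; exists (C0 * M), eta; split => //; first exact: mulr_ge0.
move=> e He x Kx; rewrite /multi_partial (cpartials_cmul _ _ (polyfun_smooth pm)).
rewrite ComplexField.Normc.normcM mulrAC ler_pM ?normc_ge0 ?H//.
by rewrite /= expr0n addr0 sqrtr_sqr HM.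
Qed.

Fact monomial_net_subproof (c : moderate_number R) (m : multinom d) :
  (fun e x => (c e : C) * (monomial m x)%:C) \in moderate_net_pred.
Proof.
apply/asboolP; split=> [e|K beta cK].
  by apply: smooth_cmul; apply: polyfun_smooth; exact: polyfun_monomial.
by have /asboolP[N HN] := valP c; exists N; exact: bigO_sup_monomial.
Qed.

Definition monomial_moderate (c : moderate_number R) (m : multinom d) :
  moderate := Moderate (monomial_net_subproof c m).

Lemma pi_monomial_moderate (c c' : moderate_number R) (m : multinom d) :
  \pi_(gcomplex R) c = \pi_(gcomplex R) c' ->
  \pi_colombeau (monomial_moderate c m) = \pi_colombeau (monomial_moderate c' m).
Proof.
move=> /eqP; rewrite -Quotient.idealrBE => /asboolP cc'.
apply/eqP/colombeau_eqP => K beta p cK.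
have := bigO_sup_monomial beta m cK (cc' p).
by under eq_fun do under [in X in multi_partial beta X]eq_fun do rewrite mulrBl.
Qed.

(* The function x |-> \sum_m p_m x^m, for chosen representatives of the
   coefficients p_m; see pi_monomial_moderate for the independence of the
   choice. *)
Definition colombeau_poly (p : mpoly d (gcomplex R)) : colombeau :=
  \sum_(m <- msupp p) \pi_colombeau (monomial_moderate (repr (mcoeff m p)) m).

End Colombeau.

(* Main.v *)
Require Import Defs.
From mathcomp Require Import all_boot all_order all_algebra.
From mathcomp Require Import all_classical all_reals all_analysis.
From mathcomp Require Import generic_quotient ring_quotient complex.
From mathcomp Require Import lra ring.
From mathcomp Require Import -(notations) mpoly.

(** Only the dilation by 1/2 is used.  Put [w = u - P], where [P] is the part of
    degree [alpha] of the Taylor polynomial of [u] at 0 (no part at all if [alpha]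
    is not a natural number).  A derivative [g] of [w] of order [k] satisfies
    [g (x / 2) = 2^(k - alpha) g x] modulo negligible terms.  If [k > alpha], the
    maximum [S] of [|g|] on a cube satisfies [S <= 2^(alpha - k) S + O(eps^m)], so
    [g] is negligible.  If [k != alpha], taking [x = 0] shows that [g 0] is
    negligible, and for [k = alpha] this holds by the choice of [P].  Descending
    induction on [k], by the mean value inequality from 0, then makes all
    derivatives of [w] negligible. *)

Import Order.TTheory GRing.Theory Num.Theory.
Local Open Scope ring_scope.

Section Calculus.
Set Implicit Arguments.
Unset Strict Implicit.
Import numFieldNormedType.Exports.
Local Open Scope classical_set_scope.
Variables (R : realType) (d : nat).
Local Notation V := 'rV[R]_d.
Implicit Types (f g : V -> R) (s t : seq 'I_d) (x y v w : V).

(** * Mean value theorem along lines and symmetry of mixed partial derivatives *)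

Lemma is_derive_line f x v (r : R) : derivable f (x + r *: v) v ->
  is_derive r 1 (fun r => f (x + r *: v)) ('D_v f (x + r *: v)).
Proof.
move=> df.
have E : (fun h : R => h^-1 *: (((fun r => f (x + r *: v)) \o shift r) (h *: 1)
      - f (x + r *: v))) =
    (fun h : R => h^-1 *: ((f \o shift (x + r *: v)) (h *: v) - f (x + r *: v))).
  apply/funext => h /=; congr (_ *: (f _ - _)).
  by rewrite -[h *: 1]/(h * 1) mulr1 scalerDl addrCA.
by apply: DeriveDef; rewrite /derivable /derive /= E.
Qed.

Lemma line_MVT f x v (h : R) : 0 <= h -> (forall y, derivable f y v) ->
  exists2 c, 0 <= c <= h & f (x + h *: v) - f x = h * 'D_v f (x + c *: v).
Proof.
move=> h0 df.
have D (t : R) : is_derive t 1 (fun r : R => f (x + r *: v)) ('D_v f (x + t *: v)).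
  exact: is_derive_line.
have C : {within `[0, h], continuous (fun r : R => f (x + r *: v))}.
  apply: continuous_subspaceT => r.
  by apply/differentiable_continuous/derivable1_diffP; have [] := D r.
have [c] := MVT_segment h0 (fun r _ => D r) C.
rewrite in_itv/= => ch; rewrite scale0r addr0 subr0 => ->.
by exists c => //; rewrite mulrC.
Qed.

Lemma smooth_real_partials s f : smooth_real f -> smooth_real (partials s f).
Proof. by move=> sf t; rewrite /partials -foldr_cat; exact: sf. Qed.

(** Two mean value steps: along [v] for the increment [F] of [f] in direction [w], then along [w]
    for ['D_v f]. *)
Lemma second_difference f i j x (h : R) : smooth_real f -> 0 < h ->
  let v := delta_mx 0 i in let w := delta_mx 0 j in
  exists a b, [/\ 0 <= a <= h, 0 <= b <= h &
    f (x + h *: v + h *: w) - f (x + h *: v) - (f (x + h *: w) - f x) =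
    h * h * partials [:: j; i] f (x + a *: v + b *: w)].
Proof.
move=> sf h0 v w.
pose F y := f (y + h *: w) - f y.
have dFs y : is_derive y v F ('D_v f (y + h *: w) - 'D_v f y).
  have d1 := (sf [::]).2 i y; have d2 := (sf [::]).2 i (y + h *: w).
  have E : is_derive y v (fun z => f (z + h *: w)) ('D_v f (y + h *: w)).
    have E : (fun k : R => k^-1 *: (((fun z => f (z + h *: w)) \o shift y) (k *: v)
        - f (y + h *: w))) =
      (fun k : R => k^-1 *: ((f \o shift (y + h *: w)) (k *: v) - f (y + h *: w))).
      by apply/funext => k /=; rewrite addrA.
    by apply: DeriveDef; rewrite /derivable /derive /= E.
  by apply: is_deriveB => //; exact: DeriveDef.
have [a ah Ea] := @line_MVT F x v h (ltW h0) (fun y => @ex_derive _ _ _ _ _ _ _ (dFs y)).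
have [b bh Eb] := @line_MVT ('D_v f) (x + a *: v) w h (ltW h0)
  (fun y => (sf [:: i]).2 j y).
exists a, b; split=> //.
rewrite -mulrA [partials _ _ _]/('D_w ('D_v f) _) -Eb.
have := dFs (x + a *: v) => /@derive_val <-; rewrite -Ea /F.
by rewrite addrAC.
Qed.

(** Meant for two mixed partials [A], [B] at a point, each close to its value at a nearby point,
    where these values agree. *)
Lemma dist_le_via (A B A' B' e : R) :
  `|A - A'| < e / 2 -> `|B - B'| < e / 2 -> A' = B' -> `|A - B| <= e.
Proof.
move=> N1 N2 AB; have -> : A - B = (A - A') - (B - B') by rewrite AB; ring.
by apply: (le_trans (ler_normB _ _)); rewrite (splitr e) lerD// ltW.
Qed.

(* Both mixed partials are limits of the same second difference quotient. *)
Lemma partials_swap f i j x : smooth_real f ->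
  partials [:: j; i] f x = partials [:: i; j] f x.
Proof.
move=> sf; apply/eqP; rewrite -subr_eq0 -normr_le0.
apply/ler_addgt0Pr => e e0; rewrite add0r.
have e2 : 0 < e / 2 by rewrite divr_gt0.
have cA := (sf [:: j; i]).1 x; have cB := (sf [:: i; j]).1 x.
move/cvgrPdist_lt : cA => /(_ _ e2) /nbhs_normP[r1 r10 H1].
move/cvgrPdist_lt : cB => /(_ _ e2) /nbhs_normP[r2 r20 H2].
pose v : V := delta_mx 0 i; pose w : V := delta_mx 0 j.
pose D := `|v| + `|w| + 1.
have D0 : 0 < D by rewrite ltr_wpDl// addr_ge0.
(* As [D] exceeds [|v| + |w|] strictly, the intermediate points of both second differences lie
   strictly within [min r1 r2] of [x]. *)
pose h := Num.min r1 r2 / D.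
have h0 : 0 < h by rewrite divr_gt0// lt_min r10.
have near a b (v' w' : V) : `|v'| + `|w'| = `|v| + `|w| ->
    0 <= a <= h -> 0 <= b <= h -> `|x - (x + a *: v' + b *: w')| < Num.min r1 r2.
  move=> E /andP[a0 ah] /andP[b0 bh].
  rewrite -addrA opprD addNKr normrN.
  apply: (le_lt_trans (ler_normD _ _)); rewrite !normrZ !ger0_norm//.
  apply: (@le_lt_trans _ _ (h * (`|v'| + `|w'|))).
    by rewrite mulrDr lerD// ler_wpM2r.
  by rewrite E -ltr_pdivlMl// /h invf_div mulrAC -mulrA divff ?mulr1 ?ltrDl//
    gt_eqF// lt_min r10.
have [a [b [ah bh E1]]] := second_difference i j x sf h0.
have [a' [b' [ah' bh' E2]]] := second_difference j i x sf h0.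
have E : partials [:: j; i] f (x + a *: v + b *: w) =
       partials [:: i; j] f (x + a' *: w + b' *: v).
  have hh : h * h != 0 by rewrite mulf_neq0// gt_eqF.
  apply: (mulfI hh); apply: (etrans (esym E1)); apply: etrans E2.
  by rewrite [x + _ + h *: v]addrAC; ring.
have := near a b v w erefl ah bh; rewrite lt_min => /andP[l1 _].
have := near a' b' w v (addrC _ _) ah' bh'; rewrite lt_min => /andP[_ l2].
apply: (dist_le_via _ _ E); first exact: (H1 _ l1).
exact: (H2 _ l2).
Qed.

Lemma partials_cons_cat f i s t : smooth_real f ->
  partials (s ++ i :: t) f = partials (i :: s ++ t) f.
Proof.
move=> sf; elim: s => //= j s ->; apply/funext => x.
exact: (@partials_swap (partials (s ++ t) f) i j x (smooth_real_partials _ sf)).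
Qed.

Lemma perm_partials f s t : smooth_real f -> perm_eq s t ->
  partials s f = partials t f.
Proof.
move=> sf; elim: s t => [|i s IH] t st; first by move: st; rewrite perm_sym => /perm_nilP ->.
have it : i \in t by rewrite -(perm_mem st) mem_head.
case/path.splitPr: it st => t1 t2 st.
rewrite partials_cons_cat//= (IH (t1 ++ t2))//.
rewrite -(perm_cons i); apply: perm_trans st _.
by rewrite -[i :: t2]cat1s perm_catCA.
Qed.

(** * Lists of directions and multi-indices *)

Definition count_multinom s : multinom d :=
  Multinom [tuple count_mem i s | i < d].

(* the sequence of directions along which [multi_partial m] differentiates *)
Definition multinom_seq (m : multinom d) : seq 'I_d :=
  flatten [seq nseq (m i) i | i <- enum 'I_d].

Lemma count_multinom_seq (m : multinom d) i : count_mem i (multinom_seq m) = m i.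
Proof.
rewrite /multinom_seq count_flatten -map_comp sumnE big_map big_enum /=.
rewrite (bigD1 i)//= count_nseq /= eqxx mul1n big1 ?addn0// => j ji.
by rewrite count_nseq /= (negPf ji).
Qed.

Lemma perm_count_multinom s : perm_eq (multinom_seq (count_multinom s)) s.
Proof. by apply/allP => i _ /=; rewrite count_multinom_seq mnmE. Qed.

Lemma size_multinom_seq m : size (multinom_seq m) = mdeg m.
Proof.
rewrite /multinom_seq size_flatten sumnE /shape -map_comp big_map big_enum /=.
by rewrite mdegE; apply: eq_bigr => i _; rewrite size_nseq.
Qed.

(** Lists of directions suit induction on the order, while moderate and negligible nets are defined
    through multi-indices; symmetry of the partial derivatives translates between the two. *)
Lemma cpartials_count_multinom (f : V -> Rcomplex R) s : smooth f ->
  cpartials s f = multi_partial (count_multinom s) f.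
Proof.
move=> [rf jf]; rewrite /multi_partial /cpartials; apply/funext => x.
by rewrite !(@perm_partials _ s (multinom_seq (count_multinom s)))// perm_sym
  perm_count_multinom.
Qed.


(** * Negligible estimates on cubes *)

Definition cube (r : R) : set V := [set x | forall i, `|x 0 i| <= r].

Lemma compact_cube r : compact (cube r).
Proof.
have := @rV_compact R d (fun=> `[- r, r]) (fun=> @segment_compact R (- r) r).
congr (compact _); apply/funext => x; apply/propext.
by split => H i; have := H i; rewrite /= in_itv/= -ler_norml.
Qed.

(** Allows cubes in place of arbitrary compact sets: for [0 <= r] they contain 0, are stable under
    halving, and contain an axis-parallel path from 0 to each of their points. *)
Lemma compact_sub_cube (K : set V) : compact K -> exists2 r, 0 <= r & K `<=` cube r.
Proof.
move=> cK.
have H i : exists M : R, 0 <= M /\ forall x : V, K x -> `|x 0 i| <= M.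
  have [M M0 HM] := compact_continuous_bound cK (@coord_continuous R 1 d 0 i).
  by exists M.
have [M HM] := choice H.
exists (\sum_i M i); first by apply: sumr_ge0 => i _; have [] := HM i.
move=> x Kx i; apply: (le_trans ((HM i).2 x Kx)).
by rewrite (bigD1 i)//= lerDl sumr_ge0// => j _; have [] := HM j.
Qed.

(** Concerns values on one set only, without derivatives; for [A = [set 0]] it is negligibility of
    the numbers [g e 0]. *)
Definition negligible_on (A : set V) (g : eps R -> V -> R) : Prop :=
  forall m : nat, exists C eta : R, [/\ 0 <= C, 0 < eta &
    forall e : eps R, val e < eta -> forall x, A x -> `|g e x| <= C * val e ^ m%:Z].

Lemma negligible_on_dominated (A : set V) (c : R) (g h : eps R -> V -> R) : 0 <= c ->
  (forall e x, A x -> `|h e x| <= c * `|g e x|) ->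
  negligible_on A g -> negligible_on A h.
Proof.
move=> c0 hg H m; have [C [eta [C0 eta0 HC]]] := H m.
exists (c * C), eta; split => //; first exact: mulr_ge0.
move=> e He x Ax; apply: (le_trans (hg e x Ax)).
by rewrite -mulrA ler_wpM2l// HC.
Qed.

(* |g| attains a maximum S on the cube, and S <= q S + O(eps^m). *)
Lemma negligible_on_contraction (g : eps R -> V -> R) (q r : R) :
  0 <= q < 1 -> 0 <= r -> (forall e, continuous (g e)) ->
  negligible_on (cube r) (fun e x => g e x - q * g e (2^-1 *: x)) ->
  negligible_on (cube r) g.
Proof.
move=> /andP[q0 q1] r0 cg H m; have [C [eta [C0 eta0 HC]]] := H m.
have q1' : 0 < 1 - q by rewrite subr_gt0.
exists (C / (1 - q)), eta; split => //; first by rewrite divr_ge0// ltW.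
move=> e He.
have ne : cube r !=set0 by exists 0 => i; rewrite mxE normr0.
have cng : {within cube r, continuous (fun x => `|g e x|)}.
  apply: continuous_subspaceT => x.
  exact: (cvg_norm (cg e x)).
have [x0 /set_mem Kx0 max] := compact_EVT_max ne (compact_cube (r := r)) cng.
have half : cube r (2^-1 *: x0).
  move=> i; rewrite mxE normrM gtr0_norm ?invr_gt0// ler_pdivrMl//.
  by rewrite (le_trans (Kx0 i))// ler_peMl// ler1n.
move=> x Kx; apply: (le_trans (max x (mem_set Kx))).
rewrite mulrAC ler_pdivlMr// mulrBr mulr1 lerBlDr.
have E : g e x0 = (g e x0 - q * g e (2^-1 *: x0)) + q * g e (2^-1 *: x0).
  by rewrite subrK.
rewrite {1}E (le_trans (ler_normD _ _))// lerD//; first exact: HC.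
by rewrite normrM (ger0_norm q0) mulrC ler_wpM2r//; exact/max/mem_set.
Qed.

(* x is reached from 0 by moving along one coordinate at a time. *)
Lemma cube_axis_path (r : R) (B : R) f : 0 <= r -> 0 <= B ->
  (forall i x, derivable f x (delta_mx 0 i)) ->
  (forall i x, cube r x -> `|'D_(delta_mx 0 i) f x| <= B) ->
  forall x, cube r x -> `|f x| <= `|f 0| + d%:R * (r * B).
Proof.
move=> r0 B0 df HB x Kx.
(* [p k] keeps the first [k] coordinates of [x], so the path runs from [p 0 = 0] to [p d = x]. *)
pose p k : V := \row_j (if (j < k)%N then x 0 j else 0).
have step y i (h : R) : cube r y -> cube r (y + h *: delta_mx 0 i) ->
    `|h| <= r -> `|f (y + h *: delta_mx 0 i) - f y| <= r * B.
  (* A negative step is a positive step taken from the other endpoint. *)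
  wlog h0 : y h / 0 <= h.
    move=> W cy cyh hr; have [h0|h0] := leP 0 h; first exact: W.
    have E : y + h *: delta_mx 0 i + (- h) *: delta_mx 0 i = y.
      by rewrite scaleNr addrK.
    rewrite distrC -{1}E; apply: W; rewrite ?E ?normrN//.
    by rewrite oppr_ge0 ltW.
  move=> cy cyh hr; have [c /andP[c0 ch] ->] := line_MVT y h0 (df i).
  rewrite normrM ler_pM//; apply: HB => j.
  (* The intermediate point stays in the cube because each of its coordinates lies between those of
     the two endpoints. *)
  have := cy j; have := cyh j; rewrite !mxE eqxx /=.
  case: (j == i); rewrite ?mulr0 ?addr0// !mulr1 !ler_norml.
  by move=> /andP[? ?] /andP[? ?]; lra.
have cp k : cube r (p k).
  by move=> j; rewrite mxE; case: ifP => // _; rewrite normr0.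
have H k : (k <= d)%N -> `|f (p k)| <= `|f 0| + k%:R * (r * B).
  elim: k => [_|k IH kd].
    rewrite mul0r addr0 (_ : p 0%N = 0)//.
    by apply/rowP => j; rewrite !mxE.
  pose i := Ordinal kd.
  have E : p k.+1 = p k + x 0 i *: delta_mx 0 i.
    apply/rowP => j; rewrite !mxE eqxx /= ltnS leq_eqVlt -[j == i]/(j == k :> nat).
    case: (ltngtP j k) => [jk|jk|jk] /=; rewrite ?mulr0 ?addr0//.
    by rewrite mulr1 add0r; congr (x _ _); apply: val_inj.
  have -> : f (p k.+1) = f (p k) + (f (p k.+1) - f (p k)) by rewrite addrC subrK.
  rewrite (le_trans (ler_normD _ _))// -natr1 mulrDl mul1r addrA lerD//.
    by apply: IH; exact: ltnW.
  by rewrite E; apply: step; rewrite -?E.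
have := H d (leqnn d); rewrite (_ : p d = x)//.
by apply/rowP => j; rewrite mxE ltn_ord.
Qed.

Lemma negligible_on_primitive (g : eps R -> V -> R) (r : R) : 0 <= r ->
  (forall e i x, derivable (g e) x (delta_mx 0 i)) ->
  negligible_on [set 0] g ->
  (forall i, negligible_on (cube r) (fun e => 'D_(delta_mx 0 i) (g e))) ->
  negligible_on (cube r) g.
Proof.
move=> r0 dg H0 HD m.
have [C [eta [C0 eta0 HC]]] := H0 m.
have H i : exists Ce : R * R, [/\ 0 <= Ce.1, 0 < Ce.2 &
    forall e : eps R, val e < Ce.2 -> forall x, cube r x ->
    `|'D_(delta_mx 0 i) (g e) x| <= Ce.1 * val e ^ m%:Z].
  by have [a [b]] := HD i m; exists (a, b).
have [Ce HCe] := choice H.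
(* There are finitely many directions, so a sum of constants and a minimum of thresholds serve for
   all of them. *)
pose B := \sum_i (Ce i).1; pose eta' := \big[Num.min/eta]_i (Ce i).2.
have B0 : 0 <= B by apply: sumr_ge0 => i _; have [] := HCe i.
exists (C + d%:R * (r * B)), eta'; split.
- by rewrite addr_ge0// !mulr_ge0.
- by apply/bigmin_gtP; split => // i _; have [] := HCe i.
move=> e /bigmin_gtP[e1 e2] x Kx.
have ep : 0 <= val e ^ m%:Z by rewrite exprz_ge0// ltW// eps_gt0.
have HB i y : cube r y -> `|'D_(delta_mx 0 i) (g e) y| <= B * val e ^ m%:Z.
  move=> Ky; have [_ _ W] := HCe i; apply: (le_trans (W e (e2 i isT) y Ky)).
  rewrite ler_wpM2r// /B (bigD1 i)//= lerDl sumr_ge0// => j _.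
  by have [] := HCe j.
have := cube_axis_path r0 (mulr_ge0 B0 ep) (dg e) HB Kx.
move=> /le_trans; apply.
by rewrite mulrDl lerD ?HC// !mulrA.
Qed.

(** * The scaling argument for real-valued nets *)

Lemma ln_half_lt0 : ln (2^-1 : R) < 0.
Proof. by rewrite ln_lt0// invr_gt0 ltr0n invf_lt1// ltr1n. Qed.

Lemma negligible_of_scaling (w : eps R -> V -> R) (alpha : R) :
  (forall e, smooth_real (w e)) ->
  (forall r s, negligible_on (cube r)
    (fun e x => partials s (fun y => w e (2^-1 *: y) - 2^-1 `^ alpha * w e y) x)) ->
  (forall s, (size s)%:R = alpha ->
    negligible_on [set 0] (fun e => partials s (w e))) ->
  forall s r, 0 <= r -> negligible_on (cube r) (fun e => partials s (w e)).
Proof.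
move=> sw hw hz.
have p0 : 0 < 2^-1 `^ alpha :> R by rewrite powR_gt0// invr_gt0.
have scal s : forall e x,
    partials s (fun y => w e (2^-1 *: y) - 2^-1 `^ alpha * w e y) x =
    2^-1 ^+ size s * partials s (w e) (2^-1 *: x) -
    2^-1 `^ alpha * partials s (w e) x.
  move=> e x.
  have -> : (fun y => w e (2^-1 *: y) - 2^-1 `^ alpha * w e y) =
     (- 2^-1 `^ alpha) *: w e + (fun y => w e (2^-1 *: y)).
    by apply/funext => y /=; rewrite fctE scaleNr addrC.
  rewrite partials_lin//; last exact: smooth_real_dilate.
  by rewrite partials_dilate//= !fctE scaleNr addrC.
have neg0 s : negligible_on [set 0] (fun e => partials s (w e)).
  have [|ne] := eqVneq (size s)%:R alpha; first exact: hz.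
  pose c : R := 2^-1 ^+ size s - 2^-1 `^ alpha.
  (* The exponential with base 1/2 is injective, so the two factors agree only if the order equals
     [alpha]. *)
  have c0 : c != 0.
    rewrite subr_eq0 -powR_mulrn ?invr_ge0//; apply: contra_neq ne.
    by move/(congr1 (@ln R)); rewrite !ln_powR; apply: mulIf; rewrite lt_eqF ?ln_half_lt0.
  (* The estimate is taken on the cube of radius 0, which contains the origin. *)
  have H : negligible_on [set 0] (fun e x =>
      partials s (fun y => w e (2^-1 *: y) - 2^-1 `^ alpha * w e y) x).
    move=> m; have [C [eta [C0 eta0 HC]]] := hw 0 s m.
    exists C, eta; split => // e He x ->; apply: HC => // i.
    by rewrite mxE normr0.
  apply: (negligible_on_dominated (c := `|c|^-1)) H; first by rewrite invr_ge0.
  move=> e x ->; rewrite scal scaler0 -mulrBl -/c normrM mulKf//.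
  by rewrite normr_eq0.
(* Here [n] is a number of further derivatives that leads past order [alpha]: contraction settles
   [n = 0], and the inductive step integrates from the origin. *)
have step n : forall s, alpha < (size s + n)%:R -> forall r, 0 <= r ->
    negligible_on (cube r) (fun e => partials s (w e)).
  elim: n => [|n IH] s sn r r0.
    rewrite addn0 in sn.
    apply: (@negligible_on_contraction _ (2^-1 `^ ((size s)%:R - alpha))) => //.
    - rewrite powR_ge0/= /powR gt_eqF ?invr_gt0// expR_lt1.
      by rewrite pmulr_rlt0 ?ln_half_lt0// subr_gt0.
    - by move=> e; exact: (sw e s).1.
    - apply: (negligible_on_dominated (c := (2^-1 `^ alpha)^-1)) (hw r s).
        by rewrite invr_ge0 powR_ge0.
      move=> e x _; rewrite scal.
      have -> : 2^-1 `^ ((size s)%:R - alpha) = 2^-1 ^+ size s / 2^-1 `^ alpha :> R.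
        rewrite powRB ?powR_mulrn ?invr_ge0//.
        by rewrite invr_eq0 pnatr_eq0 implybT.
      rewrite -[leLHS](mulKf (lt0r_neq0 p0)) -{2}(gtr0_norm p0) -normrM mulrBr.
      rewrite mulrA [_ * (_ / _)]mulrC divfK ?gt_eqF// distrC.
      by rewrite ler_pM2l ?invr_gt0.
  apply: negligible_on_primitive => //.
  - by move=> e i x; exact: (sw e s).2.
  - move=> i; apply: (IH (i :: s)) => //.
    by rewrite /= addSnnS.
(* Any natural number above [alpha] serves for every list [s]. *)
move=> s; apply: (step (Num.Def.archi_bound alpha)).
by rewrite natrD (lt_le_trans (unstable.ltr_bound alpha))// lerDr.
Qed.


(** * Derivatives of monomials *)

(** The factor [Q] in the other coordinates is constant along direction [i]. If [m i = 0], the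
    truncated subtraction is harmless since the coefficient vanishes. *)
Lemma derive_monomial (m : multinom d) i x :
  'D_(delta_mx 0 i) (monomial m) x = (m i)%:R * monomial (mnm_sub m (mnm1 i)) x.
Proof.
set v : V := delta_mx 0 i.
pose Q y : R := \prod_(j < d | j != i) y 0 j ^+ m j.
have QE y h : Q (y + h *: v) = Q y.
  by apply: eq_bigr => j ji; rewrite !mxE (negPf ji) andbF mulr0 addr0.
have dQ : is_derive x v Q 0.
  have E : (fun h : R => h^-1 *: ((Q \o shift x) (h *: v) - Q x)) = cst 0.
    by apply/funext => h /=; rewrite [h *: v + x]addrC QE subrr scaler0.
  by apply: DeriveDef; rewrite /derivable /derive E; [exact: is_cvg_cst|exact: lim_cst].
have dc : is_derive x v (fun y : V => y 0 i) 1.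
  have [_ dc] := polyfun_derive (polyfun_coord R i).
  have [/(_ x) dx _] := dc v.
  apply: DeriveDef => //.
  have := dx; rewrite /derivable /derive.
  have E : (fun h : R => h^-1 *: (((fun y : V => y 0 i) \o shift x) (h *: v) - x 0 i))
    @ 0^' --> (1 : R).
    apply: (@cvg_trans _ (cst (1 : R) @ 0^')); last exact: cvg_cst.
    apply: near_eq_cvg; near=> h.
    rewrite /= !mxE !eqxx addrK mulr1 -[RHS]/(h^-1 * h) mulVf//.
    by near: h; exact: nbhs_dnbhs_neq.
  by move=> _; exact/cvg_lim.
have ME (n : multinom d) y : monomial n y = y 0 i ^+ n i * \prod_(j < d | j != i) y 0 j ^+ n j.
  by rewrite /monomial (bigD1 i).
have -> : (monomial m : V -> R) = (fun y : V => y 0 i) ^+ m i * Q.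
  by apply/funext => y; rewrite ME !fctE.
have := is_deriveM (is_deriveX (m i) dc) dQ => /@derive_val ->.
rewrite scaler0 add0r ME mnmBE mnm1E eqxx subn1.
rewrite -[LHS]/(Q x * _) mulrC -[RHS]/(_ * _) -[_ *: 1]/(_ * 1) mulr1 -mulrA.
congr (_ * (_ * _)); apply: eq_bigr => j ji.
by rewrite mnmBE mnm1E eq_sym (negPf ji) subn0.
Unshelve. all: by end_near. Qed.

Lemma partials_monomial (m : multinom d) s :
  partials s (monomial m : V -> R) =
  (\prod_i (m i) ^_ (count_mem i s))%:R *: (monomial (mnm_sub m (count_multinom s)) : V -> R).
Proof.
elim: s => [|i s /= ->].
  rewrite big1 ?scale1r; last by move=> i _; rewrite ffactn0.
  by congr monomial; apply/mnmP => i; rewrite mnmBE mnmE subn0.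
have -> : mnm_sub m (count_multinom (i :: s)) =
    mnm_sub (mnm_sub m (count_multinom s)) (mnm1 i).
  by apply/mnmP => j; rewrite !mnmBE mnm1E !mnmE /= -subnDA addnC.
(* The new derivative contributes the last factor of the falling factorial at [i]. *)
have -> : \prod_j (m j) ^_ ((i == j) + count_mem j s) =
    (\prod_j (m j) ^_ (count_mem j s) * mnm_sub m (count_multinom s) i)%N.
  rewrite (bigD1 i)//= [in RHS](bigD1 i)//= mnmBE mnmE eqxx add1n ffactnSr.
  rewrite mulnAC; congr (_ * _)%N; apply: eq_bigr => j ji.
  by rewrite eq_sym (negPf ji).
apply/funext => x; rewrite deriveZ; last first.
  have [_ H] := polyfun_derive (polyfun_monomial R (mnm_sub m (count_multinom s))).
  by have [dm _] := H (delta_mx 0 i); exact: dm.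
by rewrite derive_monomial natrM !fctE -[RHS]/(_ * _) -mulrA.
Qed.

Lemma monomial_dilate (m : multinom d) (l : R) x :
  monomial m (l *: x) = l ^+ mdeg m * monomial m x.
Proof.
rewrite /monomial mdegE -prodrXr -big_split/=; apply: eq_bigr => i _.
by rewrite mxE exprMn.
Qed.

Definition multinom_fact (m : multinom d) : R := (\prod_i (m i)`!)%:R.

Lemma multinom_fact_gt0 m : 0 < multinom_fact m.
Proof. by rewrite ltr0n prodn_gt0// => i; exact: fact_gt0. Qed.

Lemma partials_monomial_origin (m g : multinom d) : mdeg m = mdeg g ->
  partials (multinom_seq g) (monomial m) (0 : V) = (m == g)%:R * multinom_fact g.
Proof.
move=> mg; rewrite partials_monomial !fctE.
have E : count_multinom (multinom_seq g) = g.
  by apply/mnmP => i; rewrite mnmE count_multinom_seq.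
rewrite E; have [->|ne] := eqVneq m g.
  have M1 : monomial (mnm_sub g g) 0 = 1 :> R.
    by rewrite /monomial big1// => i _; rewrite mnmBE subnn expr0.
  rewrite M1 mul1r -[LHS]/(_ * 1) mulr1.
  by under eq_bigr do rewrite count_multinom_seq ffactnn.
rewrite mul0r.
(* Otherwise [m <= g] componentwise, and equal degrees force [m = g]. At such an [i] a positive
   power of the coordinate survives and vanishes at 0. *)
have [i gi] : exists i, (g i < m i)%N.
  apply/existsP; apply: contra_neqT ne; rewrite negb_exists => /forallP H.
  have le : mpoly.lem m g by apply/mnm_lepP => i; rewrite leqNgt; exact: H.
  have := congr1 mdeg (submK le); rewrite mdegD mg -[RHS]add0n => /addIn/eqP.
  by rewrite mdeg_eq0 => /eqP z; rewrite -(submK le) z add0m.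
rewrite -[LHS]/(_ * _) [monomial _ _](bigD1 i)//= mnmBE mxE expr0n.
by rewrite subn_eq0 leqNgt gi mul0r mulr0.
Qed.
End Calculus.

Section Complex.
Set Implicit Arguments.
Unset Strict Implicit.
Import numFieldNormedType.Exports.
Local Open Scope classical_set_scope.
Local Open Scope complex_scope.
Variables (R : realType) (d : nat).
Local Notation V := 'rV[R]_d.
Local Notation C := (Rcomplex R).
Local Notation normc := (@ComplexField.Normc.normc R).
Implicit Types (u v w : moderate R d) (s : seq 'I_d) (x : V) (m g : multinom d).

(** * Passage to complex-valued nets *)

Lemma norm_Re_le (z : C) : `|complex.Re z| <= normc z.
Proof. by case: z => a b /=; rewrite -sqrtr_sqr ler_wsqrtr// lerDl sqr_ge0. Qed.

Lemma norm_Im_le (z : C) : `|complex.Im z| <= normc z.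
Proof. by case: z => a b /=; rewrite -sqrtr_sqr ler_wsqrtr// lerDr sqr_ge0. Qed.

Lemma normc_le_Re_Im (z : C) : normc z <= `|complex.Re z| + `|complex.Im z|.
Proof.
case: z => a b /=; rewrite -(ger0_norm (addr_ge0 (normr_ge0 a) (normr_ge0 b))).
rewrite -sqrtr_sqr ler_wsqrtr// sqrrD !real_normK ?num_real//.
by rewrite addrAC lerDl mulrn_wge0// mulr_ge0.
Qed.

Lemma mdeg_count_multinom s : mdeg (count_multinom s) = size s.
Proof.
by rewrite -size_multinom_seq; apply: perm_size; exact: perm_count_multinom.
Qed.

(** [pr] stands for the real or the imaginary part, so that one transfer from the real case covers
    both. *)
Lemma negligible_part (pr : C -> R) w (alpha : R) :
  (forall z, `|pr z| <= normc z) ->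
  (forall s (f : V -> C) x, pr (cpartials s f x) = partials s (fun y => pr (f y)) x) ->
  (forall a z z', pr (z - a *: z') = pr z - a * pr z') ->
  (forall e, smooth_real (fun y => pr (w e y))) ->
  negligible_net (mod_net (dilate_moderate 2^-1 w - 2^-1 `^ alpha *: w)) ->
  (forall g, (mdeg g)%:R = alpha -> forall p : nat,
    bigO_eps (fun e => (normc (multi_partial g (w e) 0))%:E) p%:Z) ->
  forall s r, 0 <= r -> negligible_on (cube r) (fun e => partials s (fun y => pr (w e y))).
Proof.
move=> prn prd prl sw hw hz.
apply: (@negligible_of_scaling _ _ (fun e y => pr (w e y)) alpha) => // [r s p|s ss p].
- have := hw (cube r) (count_multinom s) p (@compact_cube R d r).
  move=> /bigO_sup[C0 [eta [C00 eta0 H]]]; exists C0, eta; split => // e He x Kx.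
  apply: le_trans (H e He x Kx); apply: le_trans (prn _).
  have [sdw _] := moderateP (dilate_moderate 2^-1 w - 2^-1 `^ alpha *: w).
  rewrite -(cpartials_count_multinom s (sdw e)) prd.
  rewrite le_eqVlt; apply/orP; left; apply/eqP; congr (`|partials s _ x|).
  by apply/funext => y; rewrite -prl.
- have /bigO_real[C0 [eta [C00 eta0 H]]] := hz (count_multinom s)
    (etrans (congr1 _ (mdeg_count_multinom s)) ss) p.
  exists C0, eta; split => // e He x ->; apply: le_trans (H e He).
  apply: le_trans (prn _).
  have [sdw _] := moderateP w.
  by rewrite -(cpartials_count_multinom s (sdw e)) prd.
Qed.

(** The compact set is enclosed in a cube, and the modulus is bounded by the sum of the moduli of
    both parts. *)
Lemma negligible_net_of_scaling w (alpha : R) :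
  negligible_net (mod_net (dilate_moderate 2^-1 w - 2^-1 `^ alpha *: w)) ->
  (forall g, (mdeg g)%:R = alpha -> forall p : nat,
    bigO_eps (fun e => (normc (multi_partial g (w e) 0))%:E) p%:Z) ->
  negligible_net (mod_net w).
Proof.
move=> hw hz K g p cK.
have [sw _] := moderateP w.
have [r r0 Kr] := compact_sub_cube cK.
have linRe a (z z' : C) :
    complex.Re (z - a *: z') = complex.Re z - a * complex.Re z'.
  by case: z z' => ? ? [? ?].
have linIm a (z z' : C) :
    complex.Im (z - a *: z') = complex.Im z - a * complex.Im z'.
  by case: z z' => ? ? [? ?].
have [C1 [e1 [C10 e10 H1]]] := negligible_part norm_Re_le
  (fun s f x => erefl) linRe (fun e => (sw e).1) hw hz (multinom_seq g) r0 p.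
have [C2 [e2 [C20 e20 H2]]] := negligible_part norm_Im_le
  (fun s f x => erefl) linIm (fun e => (sw e).2) hw hz (multinom_seq g) r0 p.
apply/bigO_sup; exists (C1 + C2), (Num.min e1 e2).
split; [exact: addr_ge0|by rewrite lt_min e10|move=> e].
rewrite lt_min => /andP[l1 l2] x /Kr Kx.
rewrite (le_trans (normc_le_Re_Im _))// mulrDl lerD//.
  exact: H1.
exact: H2.
Qed.

(** * Derivatives of sums of nets and Taylor coefficients at the origin *)

Lemma moderate_sum_apply (I : Type) (r : seq I) (F : I -> moderate R d) (e : eps R) x :
  mod_net (\sum_(i <- r) F i) e x = \sum_(i <- r) (mod_net (F i) e x : C).
Proof. exact: (big_morph (fun u : moderate R d => mod_net u e x : C)). Qed.

Lemma multi_partialD g u v (e : eps R) x :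
  multi_partial g (mod_net (u + v) e) x =
  multi_partial g (mod_net u e) x + multi_partial g (mod_net v e) x :> C.
Proof.
have [su _] := moderateP u; have [sv _] := moderateP v.
have := cpartials_lin (multinom_seq g) 1 (su e) (sv e); rewrite !scale1r.
by move=> /(congr1 (fun f => f x)).
Qed.

Lemma multi_partialN g u (e : eps R) x :
  multi_partial g (mod_net (- u) e) x = - multi_partial g (mod_net u e) x :> C.
Proof.
apply/eqP; rewrite -subr_eq0 opprK -multi_partialD addNr; apply/eqP.
by have := cpartials0 R (multinom_seq g) => /(congr1 (fun f => f x)).
Qed.

Lemma multi_partial_sum (I : Type) (r : seq I) (F : I -> moderate R d) g e x :
  multi_partial g (mod_net (\sum_(i <- r) F i) e) x =
  \sum_(i <- r) (multi_partial g (mod_net (F i) e) x : C).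
Proof.
apply: (big_morph (fun u : moderate R d => multi_partial g (mod_net u e) x : C)).
  by move=> u v; exact: multi_partialD.
by have := cpartials0 R (multinom_seq g) => /(congr1 (fun f => f x)).
Qed.

Lemma multi_partial_monomial_origin (c : moderate_number R) m g (e : eps R) :
  mdeg m = mdeg g ->
  multi_partial g (mod_net (monomial_moderate c m) e) 0 =
  (c e : C) * ((m == g)%:R * multinom_fact R g)%:C.
Proof.
move=> mg; rewrite -partials_monomial_origin//.
have := cpartials_cmul (multinom_seq g) (c e) (polyfun_smooth (polyfun_monomial R m)).
by move=> /(congr1 (fun f => f 0)).
Qed.

(** The singleton of 0 is compact, so moderateness of [u] bounds its derivatives there. *)
Fact taylor_coef_subproof u g :
  (fun e => (multinom_fact R g)^-1 *: (multi_partial g (mod_net u e) 0 : C))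
    \in @moderate_num_pred R.
Proof.
apply/asboolP; have [_ mu] := moderateP u.
have [N /bigO_sup[C0 [eta [C00 eta0 H]]]] := mu [set 0] g (@compact_set1 V 0).
exists N; apply/bigO_real; exists (`|(multinom_fact R g)^-1| * C0), eta.
split => // [|e He]; first by rewrite mulr_ge0.
by rewrite normcZ -mulrA ler_wpM2l// H.
Qed.

Definition taylor_coef u g : moderate_number R :=
  ModerateNumber (taylor_coef_subproof u g).

End Complex.

(** * The homogeneous polynomial and the conclusion *)

Lemma homogeneous_repr (R : realType) (d : nat) (u : colombeau R d) (alpha : R) :
  homogeneous alpha u ->
  negligible_net (mod_net (dilate_moderate 2^-1 (repr u) - 2^-1 `^ alpha *: repr u)).
Proof. by move=> hu; apply/colombeau_eqP/eqP; apply: hu; rewrite invr_gt0. Qed.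

Lemma normc_mul_real (R : realType) (z : Rcomplex R) (a : R) :
  z * a%:C%C = a *: z :> Rcomplex R.
Proof.
by case: z => b c; apply/eqP; rewrite eq_complex /= !mulr0 subr0 add0r !(mulrC a) !eqxx.
Qed.

Lemma homogeneous_polynomial (R : realType) (d : nat) (u : colombeau R d) (n : nat) :
  homogeneous n%:R u ->
  exists p : mpoly d (gcomplex R), p \is ishomog1 n (@mdeg d) /\ u = colombeau_poly p.
Proof.
move=> /homogeneous_repr; set U := repr u => hU.
(* The finite type [bmultinom d n.+1] holds all multi-indices of degree at most [n]; [E] is zero on
   those of degree below [n]. *)
pose E g : gcomplex R := if mdeg g == n then (\pi_(gcomplex R) (taylor_coef U g))%qT else 0.
pose p : mpoly d (gcomplex R) :=
  \sum_(m : bmultinom d n.+1) E (bmnm m) *: mpolyX _ (bmnm m).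
have ph : p \is ishomog1 n (@mdeg d).
  apply: rpred_sum => m _; rewrite /E; case: ifP => [mn|_].
    by apply: dhomogZ; rewrite dhomogX.
  by rewrite scale0r rpred0.
exists p; split => //.
pose P : moderate R d :=
  \sum_(m <- msupp p) monomial_moderate (repr (mcoeff m p)) m.
have -> : colombeau_poly p = (\pi_(colombeau R d) P)%qT by rewrite raddf_sum.
rewrite -[LHS]reprK; apply/eqP/colombeau_eqP; rewrite -/U.
have Pdeg m : m \in msupp p -> mdeg m = n by apply/dhomogP.
apply: (@negligible_net_of_scaling R d (U - P) n%:R).
  (* All monomials of [p] have degree [n], so the net [P] scales exactly and drops out. *)
  have -> : dilate_moderate 2^-1 (U - P) - 2^-1 `^ n%:R *: (U - P) =
      dilate_moderate 2^-1 U - 2^-1 `^ n%:R *: U; last exact: hU.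
    apply: val_inj; apply/funext => e; apply/funext => x.
    change ((U e (2^-1 *: x) - P e (2^-1 *: x)) - 2^-1 `^ n%:R *: (U e x - P e x) =
      U e (2^-1 *: x) - 2^-1 `^ n%:R *: U e x :> Rcomplex R).
    have -> : P e (2^-1 *: x) = 2^-1 `^ n%:R *: P e x :> Rcomplex R.
      rewrite !moderate_sum_apply scaler_sumr powR_mulrn ?invr_ge0//.
      rewrite !big_seq; apply: eq_bigr => m /Pdeg mn /=.
      by rewrite monomial_dilate mn !normc_mul_real scalerA.
    by rewrite scalerBr opprB addrA subrK.
move=> g /eqP; rewrite eqr_nat => /eqP gn q.
have cg : mcoeff g p = (\pi_(gcomplex R) (taylor_coef U g))%qT.
  by rewrite mcoeff_mpoly ?gn// /E gn eqxx.
(* The coefficient of [g] actually present in [P]: outside the support it is exactly 0, whereas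
   [repr 0] would be some negligible net. *)
pose t : moderate_number R := if g \in msupp p then repr (mcoeff g p) else 0.
have tg : (\pi_(gcomplex R) (taylor_coef U g - t) = 0)%qT.
  rewrite rmorphB /= -cg /t; case: ifPn => [_|]; first by rewrite reprK subrr.
  by rewrite -mcoeff_eq0 => /eqP ->; rewrite raddf0 subr0.
have tn : negligible_num (taylor_coef U g - t).
  move: tg; rewrite -[0](raddf0 (\pi_(gcomplex R))%qT) => /eqP.
  by rewrite -Quotient.idealrBE subr0 => /asboolP.
(* Among the monomials of degree [n], only that of exponent [g] has a nonzero derivative of index
   [g] at 0. *)
have Pg e : multi_partial g (mod_net P e) 0 = multinom_fact R g *: (t e : Rcomplex R).
  rewrite multi_partial_sum.
  have -> : \sum_(m <- msupp p) (multi_partial g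
        (mod_net (monomial_moderate (repr (mcoeff m p)) m) e) 0 : Rcomplex R) =
      \sum_(m <- msupp p) (if m == g then
        multinom_fact R g *: (mnum_net (repr (mcoeff m p)) e : Rcomplex R) else 0).
    rewrite !big_seq; apply: eq_bigr => m /Pdeg mn.
    rewrite multi_partial_monomial_origin ?mn ?gn// normc_mul_real.
    by case: eqP => _; rewrite ?mul1r// mul0r scale0r.
  rewrite /t; case: ifPn => gp.
    by rewrite (bigD1_seq g gp (msupp_uniq p))/= eqxx big1 ?addr0// => m /negPf ->.
  rewrite big1_seq ?scaler0// => m /andP[_ mp].
  by case: eqP => // mg; rewrite -mg mp in gp.
have [C0 [eta [C00 eta0 H]]] := (bigO_real _ _).1 (tn q).
apply/bigO_real; exists (multinom_fact R g * C0), eta; split => // [|e He].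
  by rewrite mulr_ge0// ltW// multinom_fact_gt0.
rewrite multi_partialD multi_partialN Pg.
have fg := multinom_fact_gt0 R g.
have -> : multi_partial g (mod_net U e) 0 =
    multinom_fact R g *: (taylor_coef U g e : Rcomplex R).
  by rewrite /= scalerA divff ?scale1r// gt_eqF.
rewrite -scalerBr normcZ gtr0_norm// -mulrA ler_pM2l//.
exact: H.
Qed.

Theorem theorem4p7 (R : realType) (d : nat) (hd : (0 < d)%N)
    (u : colombeau R d) (alpha : R) (hu0 : u != 0)
    (hu : homogeneous alpha u) :
  exists n : nat, alpha = n%:R /\
    exists p : mpoly d (gcomplex R),
      p \is ishomog1 n (@mdeg d) /\ u = colombeau_poly p.
Proof.
have [[n an]|nn] := pselect (exists n : nat, alpha = n%:R).
  by exists n; split => //; apply: homogeneous_polynomial; rewrite -an.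
exfalso; move/eqP: hu0; apply; rewrite -[u]reprK -[RHS](raddf0 (\pi_(colombeau R d))%qT).
apply/eqP/colombeau_eqP; rewrite subr0.
(* No multi-index has degree [alpha], so the condition at the origin is vacuous and the
   representative of [u] is itself negligible. *)
apply: (negligible_net_of_scaling (homogeneous_repr hu)) => g ga.
by case: nn; exists (mdeg g).
Qed.
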